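(* For every $n\ge 0$, $|A_n|=Fb(n+3)$ and $|D_{n+1}|=|A_n|$.
   Context: The Fibonacci sequence $Fb:\{1,2,3,\dots\}\to\{1,2,3,\dots\}$ is given by $Fb(1)=1$, $Fb(2)=1$, $Fb(k)=Fb(k-1)+Fb(k-2)$ for $k\ge3$. Let $2=\{0,1\}$. The sets $A_n\subseteq 2^{n+1}$ are defined recursively: $A_0=\{0,1\}$; for $n\ge1$, $A_n$ is the set of $(x_0,\dots,x_n)\in 2^{n+1}$ such that $(x_0,\dots,x_{n-1})\in A_{n-1}$ and, if $x_{n-1}=0$, then $x_n=1$ (no restriction on $x_n$ if $x_{n-1}=1$). For $n\ge0$, $D_n=\{\vec{x}=(x_0,\dots,x_n)\in A_n: x_0=1\}$. *)

(* Defs.v *)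
From mathcomp Require Import all_boot.

Set Implicit Arguments.
Unset Strict Implicit.
Unset Printing Implicit Defensive.

(* The domain of Fb is {1, 2, ...}; the value at 0 is a junk value. *)
Fixpoint Fb (k : nat) : nat :=
  match k with
  | 0 => 0
  | 1 => 1
  | 2 => 1
  | (k2.+1 as k1).+1 => Fb k1 + Fb k2
  end.

(* 2 = {0, 1} is bool, with 0 = false and 1 = true; a tuple (x_0, ..., x_n)
   in 2^(n+1) is a finite function x on 'I_n.+1 with x_i = x i. *)
Definition vec (n : nat) := {ffun 'I_n.+1 -> bool}.

(* (x_0, ..., x_n, x_{n+1}) |-> (x_0, ..., x_n) *)
Definition trunc (n : nat) (x : vec n.+1) : vec n :=
  [ffun i : 'I_n.+1 => x (widen_ord (leqnSn n.+1) i)].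

(* In the successor case, [trunc x ord_max] is the entry x_n preceding the
   last entry [x ord_max] = x_{n+1}. *)
Fixpoint A (n : nat) : {set vec n} :=
  match n return {set vec n} with
  | 0 => [set: vec 0]
  | m.+1 => [set x : vec m.+1 | (trunc x \in A m) &&
                ((trunc x ord_max == false) ==> (x ord_max == true))]
  end.

Definition D (n : nat) : {set vec n} := [set x in A n | x ord0 == true].

(* Main.v *)
Require Import Defs.
From mathcomp Require Import all_boot.

(** Both cardinalities are counted at the same time, by splitting on the last
    entry.  Let [a n] be the number of vectors of [A n] whose first entry
    satisfies a fixed predicate [P], and [o n] the number of those among them
    that end in 1.  A last entry 1 may always be appended, and a last entry 0
    may be appended exactly to the vectors ending in 1.  Hence
    [o n.+1 = a n] ([card_restrA_last]) and [a n.+1 = a n + o n]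
    ([card_restrAS]), so that [a n.+2 = a n.+1 + a n] for every [P].
    The sets [A n] and [D n] are the cases where [P] is always true and where
    [P] selects 1: the first sequence starts with 2, 3 and the second with
    1, 2, 3, so they are the Fibonacci sequence up to a shift. *)

Definition snoc (n : nat) (b : bool) (x : vec n) : vec n.+1 :=
  [ffun i : 'I_n.+2 => if insub (val i) is Some j then x j else b].

Lemma snoc_max n b (x : vec n) : snoc n b x ord_max = b.
Proof. by rewrite ffunE insubF //= ltnn. Qed.

Lemma trunc_snoc n b (x : vec n) : trunc (snoc n b x) = x.
Proof. by apply/ffunP => i; rewrite !ffunE /= valK. Qed.

Lemma snoc_trunc n (x : vec n.+1) : snoc n (x ord_max) (trunc x) = x.
Proof.
apply/ffunP => i; rewrite ffunE; case: insubP => [j _ ji | ].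
  by rewrite ffunE; congr (x _); apply: val_inj; rewrite /= -ji.
rewrite -leqNgt => ni; congr (x _); apply: val_inj.
by apply/eqP; rewrite eqn_leq ni -ltnS ltn_ord.
Qed.

Lemma trunc0 n (x : vec n.+1) : trunc x ord0 = x ord0.
Proof. by rewrite ffunE; congr (x _); apply: val_inj. Qed.

(** Once the last entry is prescribed, [trunc] is a bijection with inverse
    [snoc]. *)
Lemma card_trunc_last n b (S : {set vec n}) :
  #|[set x : vec n.+1 | (trunc x \in S) && (x ord_max == b)]| = #|S|.
Proof.
rewrite -(card_imset (mem S) (can_inj (trunc_snoc n b))).
apply: eq_card => x; rewrite inE; apply/andP/imsetP => [[xS /eqP <-]|[y yS ->]].
  by exists (trunc x) => //; rewrite snoc_trunc.
by rewrite trunc_snoc snoc_max.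
Qed.

Lemma card_vec0 (Q : pred bool) : #|[set x : vec 0 | Q (x ord0)]| = #|Q|.
Proof.
have cK : cancel (fun b => [ffun=> b] : vec 0) (fun x => x ord0).
  by move=> b; rewrite ffunE.
rewrite -(card_imset Q (can_inj cK)).
apply: eq_card => x; rewrite inE; apply/idP/imsetP => [Qx|[b Qb ->]].
  by exists (x ord0) => //; apply/ffunP => i; rewrite ffunE (ord1 i).
by rewrite ffunE.
Qed.

Section FirstEntry.

Variable P : pred bool.

Definition restrA (n : nat) : {set vec n} := [set x in A n | P (x ord0)].

Definition restrA_last (n : nat) : {set vec n} :=
  [set x in restrA n | x ord_max == true].

Lemma card_restrA_last n : #|restrA_last n.+1| = #|restrA n|.
Proof.
rewrite -(card_trunc_last n true); apply: eq_card => x.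
by rewrite !inE trunc0; case: (x ord_max); rewrite /= ?implybT ?andbT ?andbF.
Qed.

Lemma card_restrAS n : #|restrA n.+1| = #|restrA n| + #|restrA_last n|.
Proof.
rewrite -(cardsID [set x : vec n.+1 | x ord_max == true]).
rewrite -(card_trunc_last n true) -(card_trunc_last n false (restrA_last n)).
by congr (_ + _); apply: eq_card => x; rewrite !inE trunc0;
  case: (x ord_max); case: (trunc x ord_max); case: (_ \in A n);
  rewrite /= ?andbT ?andbF.
Qed.

Lemma card_restrASS n : #|restrA n.+2| = #|restrA n.+1| + #|restrA n|.
Proof. by rewrite card_restrAS card_restrA_last. Qed.

Lemma card_restrA0 : #|restrA 0| = P true + P false.
Proof.
rewrite -sum1_card (eq_bigl [in [set x : vec 0 | P (x ord0)]]); last first.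
  by move=> x; rewrite !inE.
by rewrite sum1_card card_vec0 -sum1_card big_mkcond big_bool !unfold_in; do 2!case: (P _).
Qed.

Lemma card_restrA1 : #|restrA 1| = P true + P false + P true.
Proof.
rewrite card_restrAS card_restrA0; congr (_ + _).
transitivity #|[pred b | P b && (b == true)]|.
  rewrite -card_vec0; apply: eq_card => x.
  by rewrite !inE /= (ord1 ord_max).
by rewrite -sum1_card big_mkcond big_bool !unfold_in /= andbT andbF; case: (P _).
Qed.

End FirstEntry.

Lemma FbSS k : Fb k.+3 = Fb k.+2 + Fb k.+1.
Proof. by []. Qed.

(** The recurrence has order two, so the induction carries two consecutive
    values. *)
Lemma fib_shift (u : nat -> nat) k :
    u 0 = Fb k.+1 -> u 1 = Fb k.+2 -> (forall n, u n.+2 = u n.+1 + u n) ->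
  forall n, u n = Fb (n + k.+1).
Proof.
move=> u0 u1 uSS n.
suff [] : u n = Fb (n + k.+1) /\ u n.+1 = Fb (n.+1 + k.+1) by [].
elim: n => [|n [IH1 IH2]]; first by [].
by split=> //; rewrite uSS IH1 IH2 !addSn addnS FbSS.
Qed.

Theorem mainTheorem2 (n : nat) :
  #|A n| = Fb (n + 3) /\ #|D n.+1| = #|A n|.
Proof.
have cardA : #|A n| = Fb (n + 3).
  have -> : #|A n| = #|restrA predT n|.
    by apply: eq_card => x; rewrite inE andbT.
  apply: (fib_shift (fun m => #|restrA predT m|)).
  - by rewrite card_restrA0.
  - by rewrite card_restrA1.
  - exact: card_restrASS.
split=> //; rewrite cardA.
(* [D m] is convertible to [restrA (eq_op^~ true) m]. *)
apply: (fib_shift (fun m => #|D m.+1|)).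
- by rewrite (card_restrA1 (eq_op^~ true)).
- by rewrite (card_restrASS (eq_op^~ true)) card_restrA1 card_restrA0.
- by move=> m; apply: (card_restrASS (eq_op^~ true)).
Qed.
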